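(* (UGS small-gain theorem in semi-maximum formulation.) Let $I$ be an arbitrary nonempty index set, let $(X_i,\|\cdot\|_{X_i})$, $i\in I$, be normed spaces and let $\Sigma_i=(X_i,\mathrm{PC}_b(\mathbb{R}_+,X_{\neq i})\times\mathcal{U},\bar\phi_i)$, $i\in I$, be forward complete control systems. Assume that the interconnection $\Sigma=(X,\mathcal{U},\phi)$ of the systems $\Sigma_i$ is well-defined. Furthermore, assume: (i) Each system $\Sigma_i$ is UGS in semi-maximum formulation, with $\sigma_i\in\mathcal{K}$ and nonlinear gains $\gamma_{ij},\gamma_i\in\mathcal{K}\cup\{0\}$ ($j\in I$). (ii) There exist $\sigma_{\max}\in\mathcal{K}_\infty$ and $\gamma_{\max}\in\mathcal{K}_\infty$ such that $\sigma_i\le\sigma_{\max}$ and $\gamma_i\le\gamma_{\max}$ pointwise for all $i\in I$. (iii) For the gains $\gamma_{ij}$ from (i) it holds that $\sup_{i,j\in I}\gamma_{ij}(r)<\infty$ for every $r>0$, and, for the operator $\Gamma_\otimes:\ell_\infty(I)^+\to\ell_\infty(I)^+$, $\Gamma_\otimes(s):=(\sup_{j\in I}\gamma_{ij}(s_j))_{i\in I}$, the operator $\mathrm{id}-\Gamma_\otimes$ has the MBI property. Then $\Sigma$ is forward complete and UGS.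
   Context: **Comparison functions.** $\mathcal{K}$: continuous strictly increasing $\gamma:\mathbb{R}_+\to\mathbb{R}_+$ with $\gamma(0)=0$. $\mathcal{K}_\infty$: unbounded functions in $\mathcal{K}$. In $\mathcal{K}\cup\{0\}$, $0$ is the zero function. **Sequence spaces.** $\ell_\infty(I)$ is the Banach space of bounded functions $x:I\to\mathbb{R}$ with the sup-norm; $\ell_\infty(I)^+$ is the cone of its componentwise nonnegative elements; $\le$ is the componentwise order. For $w:J\to W$ bounded, $J\subset\mathbb{R}_+$ nonempty, $W$ normed, $\|w\|_J:=\sup_{s\in J}\|w(s)\|_W$. **MBI property.** For an ordered Banach space $(X,X^+)$ and a (nonlinear) operator $A:X^+\to X^+$, $\mathrm{id}-A$ has the monotone bounded invertibility (MBI) property if there is $\xi\in\mathcal{K}_\infty$ such that for all $v,w\in X^+$: $(\mathrm{id}-A)(v)\le w$ implies $\|v\|_X\le\xi(\|w\|_X)$. Here it is used with $X=\ell_\infty(I)$, $X^+=\ell_\infty(I)^+$. **Control systems.** A control system is a triple $\Sigma=(X,\mathcal{U},\phi)$ with: a normed space $(X,\|\cdot\|_X)$ (state space); a vector space $U$ of input values and a normed space of inputs $(\mathcal{U},\|\cdot\|_{\mathcal{U}})$, $\mathcal{U}$ a linear subspace of $U^{\mathbb{R}_+}$ (all maps $\mathbb{R}_+\to U$), satisfying shift invariance (for all $u\in\mathcal{U}$, $\tau\ge0$: $u(\cdot+\tau)\in\mathcal{U}$ and $\|u\|_{\mathcal{U}}\ge\|u(\cdot+\tau)\|_{\mathcal{U}}$)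 and concatenation (for all $u_1,u_2\in\mathcal{U}$, $t>0$, the function equal to $u_1(\tau)$ for $\tau\in[0,t]$ and $u_2(\tau-t)$ for $\tau>t$ is in $\mathcal{U}$); a transition map $\phi:D_\phi\to X$, $D_\phi\subseteq\mathbb{R}_+\times X\times\mathcal{U}$, such that for all $(x,u)$ one has $D_\phi\cap(\mathbb{R}_+\times\{(x,u)\})=[0,t_m)\times\{(x,u)\}$ for some $t_m=t_m(x,u)\in(0,\infty]$. The following axioms are required: $\phi(0,x,u)=x$; causality (if $(t,x,u)\in D_\phi$ and $\tilde u\in\mathcal{U}$ agrees with $u$ on $[0,t]$, then $[0,t]\times\{(x,\tilde u)\}\subset D_\phi$ and $\phi(t,x,u)=\phi(t,x,\tilde u)$); continuity of $t\mapsto\phi(t,x,u)$ on $[0,t_m(x,u))$; cocycle property (if $[0,t+h]\times\{(x,u)\}\subset D_\phi$, $t,h\ge 0$, then $\phi(h,\phi(t,x,u),u(t+\cdot))=\phi(t+h,x,u)$). $\Sigma$ is forward complete if $D_\phi=\mathbb{R}_+\times X\times\mathcal{U}$. $\Sigma$ has the boundedness-implies-continuation (BIC) property if for each $(x,u)$ with $t_m(x,u)<\infty$ and each $M>0$ there is $t\in[0,t_m)$ with $\|\phi(t,x,u)\|_X>M$. **UGS.** $\Sigma$ is uniformly globally stable (UGS) if there are $\sigma\in\mathcal{K}_\infty$, $\gamma\in\mathcal{K}\cup\{0\}$ with $\|\phi(t,x,u)\|_X\le\sigma(\|x\|_X)+\gamma(\|u\|_{\mathcal{U}})$ for all $(t,x,u)\in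 D_\phi$. **Interconnections.** Given normed spaces $X_i$, $i\in I$, put $X:=\{(x_i)_{i\in I}\in\prod_i X_i:\sup_i\|x_i\|_{X_i}<\infty\}$ with $\|x\|_X:=\sup_i\|x_i\|_{X_i}$, and let $X_{\neq i}$ be the same construction for the index set $I\setminus\{i\}$. $\mathrm{PC}_b(\mathbb{R}_+,X_{\neq i})$ is the space of globally bounded piecewise continuous functions $w:\mathbb{R}_+\to X_{\neq i}$ with sup-norm $\|w\|_\infty$. $\mathcal{U}$ is a fixed normed space of inputs (satisfying shift invariance and concatenation), common to all subsystems, and $\mathrm{PC}_b(\mathbb{R}_+,X_{\neq i})\times\mathcal{U}$ has norm $\max\{\|w\|_\infty,\|u\|_{\mathcal{U}}\}$. Given control systems $\Sigma_i=(X_i,\mathrm{PC}_b(\mathbb{R}_+,X_{\neq i})\times\mathcal{U},\bar\phi_i)$, consider maps $\phi:D_\phi\to X$, $D_\phi\subset\mathbb{R}_+\times X\times\mathcal{U}$, such that (1) for each $(x,u)\in X\times\mathcal{U}$ there is $\varepsilon>0$ with $[0,\varepsilon]\times\{(x,u)\}\subset D_\phi$; (2) the components satisfy $\phi_i(t,x,u)=\bar\phi_i(t,x_i,(\phi_{\neq i},u))$ for all $(t,x,u)\in D_\phi$, $i\in I$, where $\phi_{\neq i}(\cdot)=(\phi_j(\cdot,x,u))_{j\in I\setminus\{i\}}$ (by causality only the values of $\phi_{\neq i}$ on $[0,t]$ matter, so it can be regarded as globally bounded); and $\phi$ is maximal, i.e. no proper extension of $\phi$ satisfies these properties. If the map $\phi$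 with these properties is unique and $\Sigma=(X,\mathcal{U},\phi)$ is a control system satisfying the BIC property, then $\Sigma$ is called the (well-defined) interconnection of the $\Sigma_i$. **UGS of $\Sigma_i$ in semi-maximum formulation.** $\Sigma_i$ is forward complete and there are $\sigma_i$ and $\gamma_{ij},\gamma_i\in\mathcal{K}\cup\{0\}$ ($j\in I$) such that for all $x_i\in X_i$, $w_{\neq i}=(w_j)_{j\in I\setminus\{i\}}\in\mathrm{PC}_b(\mathbb{R}_+,X_{\neq i})$, $u\in\mathcal{U}$, $t\ge0$: $\|\bar\phi_i(t,x_i,(w_{\neq i},u))\|_{X_i}\le\sigma_i(\|x_i\|_{X_i})+\sup_{j\in I}\gamma_{ij}(\|w_j\|_{[0,t]})+\gamma_i(\|u\|_{\mathcal{U}})$, where $\sup_{j\in I}\gamma_{ij}(r)<\infty$ for every $r\ge0$ and $\gamma_{ii}=0$ (so the term $j=i$ is $0$). *)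

(* Defs.v *)
From HB Require Import structures.
From mathcomp Require Import all_boot all_order all_algebra.
From mathcomp Require Import interval_inference.
From mathcomp Require Import all_classical all_reals topology normedtype.

Set Implicit Arguments.
Unset Strict Implicit.
Unset Printing Implicit Defensive.
Import Order.TTheory GRing.Theory Num.Theory.
Import numFieldNormedType.Exports.
Local Open Scope classical_set_scope.
Local Open Scope ring_scope.

(* Comparison functions are total on R, but only their restriction to
   [0, +oo[ is ever constrained or used; class_K forces it to be a map of
   [0, +oo[ into itself. *)

Definition class_K (R : realType) (g : R -> R) : Prop :=
  [/\ g 0 = 0,
      {within [set r : R | 0 <= r], continuous g} &
      forall r s : R, 0 <= r -> r < s -> g r < g s].

Definition class_Kinfty (R : realType) (g : R -> R) : Prop :=
  class_K g /\ forall M : R, exists2 r : R, 0 <= r & M < g r.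

Definition class_K0 (R : realType) (g : R -> R) : Prop :=
  class_K g \/ forall r : R, 0 <= r -> g r = 0.

Lemma class_K0_0 (R : realType) (g : R -> R) : class_K0 g -> g 0 = 0.
Proof. by case=> [[]//|]; apply. Qed.

Lemma class_K0_le (R : realType) (g : R -> R) (r s : R) :
  class_K0 g -> 0 <= r -> r <= s -> g r <= g s.
Proof.
move=> [[_ _ h]|h] r0; last by move=> rs; rewrite !h// (le_trans r0).
by rewrite le_eqVlt => /predU1P[->//|rs]; exact/ltW/h.
Qed.

Lemma class_K0_ge0 (R : realType) (g : R -> R) (r : R) :
  class_K0 g -> 0 <= r -> 0 <= g r.
Proof. by move=> h r0; rewrite -(class_K0_0 h); exact: class_K0_le. Qed.

(* As sup set0 = 0, this is also the right norm for an empty index set. *)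
Definition fam_norm (R : realType) (I : Type) (X : I -> normedModType R)
  (x : forall i, X i) : R := sup (range (fun i => `|x i|)).

Definition fam_bounded (R : realType) (I : Type) (X : I -> normedModType R)
  (x : forall i, X i) : Prop := has_ubound (range (fun i => `|x i|)).

Section fam_norm.
Variables (R : realType) (I : Type) (X : I -> normedModType R).
Implicit Types x y : forall i, X i.

Lemma fam_boundedP x M : (forall i, `|x i| <= M) -> fam_bounded x.
Proof. by move=> h; exists M => _ [i _ <-]. Qed.

Lemma fam_norm_ub x i : fam_bounded x -> `|x i| <= fam_norm x.
Proof. by move=> h; apply: ub_le_sup => //; exists i. Qed.

Lemma fam_norm_le x M : 0 <= M -> (forall i, `|x i| <= M) -> fam_norm x <= M.
Proof.
move=> M0 h; have [E|/set0P E] := eqVneq (range (fun i => `|x i|)) set0.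
  by rewrite /fam_norm E sup0.
by apply: ge_sup => // _ [i _ <-].
Qed.

Lemma fam_norm_ge0 x : 0 <= fam_norm x.
Proof.
rewrite /fam_norm; have [b|nb] := pselect (fam_bounded x); last first.
  by rewrite sup_out// => -[].
have [->|/set0P[_ [i _ _]]] := eqVneq (range (fun i => `|x i|)) set0.
  by rewrite sup0.
by rewrite (le_trans (normr_ge0 (x i)))//; exact: fam_norm_ub.
Qed.

Lemma fam_bounded0 : fam_bounded (fun i => 0 : X i).
Proof. by apply: (@fam_boundedP _ 0) => i; rewrite normr0. Qed.

Lemma fam_boundedN x : fam_bounded x -> fam_bounded (fun i => - x i).
Proof.
move=> h; apply: (@fam_boundedP _ (fam_norm x)) => i.
by rewrite normrN fam_norm_ub.
Qed.

Lemma fam_boundedD x y :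
  fam_bounded x -> fam_bounded y -> fam_bounded (fun i => x i + y i).
Proof.
move=> hx hy; apply: (@fam_boundedP _ (fam_norm x + fam_norm y)) => i.
by rewrite (le_trans (ler_normD _ _))// lerD// fam_norm_ub.
Qed.

Lemma fam_boundedZ (a : R) x :
  fam_bounded x -> fam_bounded (fun i => a *: x i).
Proof.
move=> h; apply: (@fam_boundedP _ (`|a| * fam_norm x)) => i.
by rewrite normrZ ler_wpM2l// fam_norm_ub.
Qed.

Lemma fam_normD x y : fam_bounded x -> fam_bounded y ->
  fam_norm (fun i => x i + y i) <= fam_norm x + fam_norm y.
Proof.
move=> hx hy; apply: fam_norm_le => [|i].
  by rewrite addr_ge0 ?fam_norm_ge0.
by rewrite (le_trans (ler_normD _ _))// lerD// fam_norm_ub.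
Qed.

Lemma fam_normZ (a : R) x : fam_bounded x ->
  fam_norm (fun i => a *: x i) = `|a| * fam_norm x.
Proof.
move=> h; apply/eqP; rewrite eq_le; apply/andP; split.
  apply: fam_norm_le => [|i]; first by rewrite mulr_ge0 ?fam_norm_ge0.
  by rewrite normrZ ler_wpM2l// fam_norm_ub.
have [->|a0] := eqVneq a 0; first by rewrite normr0 mul0r fam_norm_ge0.
have a0' : 0 < `|a| by rewrite normr_gt0.
rewrite mulrC -ler_pdivlMr//; apply: fam_norm_le => [|i].
  by rewrite divr_ge0 ?fam_norm_ge0.
rewrite ler_pdivlMr// mulrC -normrZ.
by apply: (@fam_norm_ub (fun i => a *: x i)); exact: fam_boundedZ.
Qed.

Lemma fam_norm_eq0 x : fam_bounded x -> fam_norm x = 0 -> forall i, x i = 0.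
Proof.
by move=> h h0 i; apply/normr0_eq0/le_anti; rewrite normr_ge0 -h0 fam_norm_ub.
Qed.

End fam_norm.

Record linfty (R : realType) (I : Type) (X : I -> normedModType R) := Linfty {
  linfty_fun :> forall i, X i;
  linfty_bounded : fam_bounded linfty_fun }.

Section linfty_normed.
Variables (R : realType) (I : Type) (X : I -> normedModType R).
Local Notation T := (linfty X).
Implicit Types x y : T.

Lemma linfty_eq x y : (forall i, x i = y i) -> x = y.
Proof.
case: x y => [x bx] [y by_] /= E.
have {}E : x = y by apply: functional_extensionality_dep.
by subst y; congr Linfty; exact: Prop_irrelevance.
Qed.

HB.instance Definition _ := gen_eqMixin T.
HB.instance Definition _ := gen_choiceMixin T.

Definition linfty_zero : T := Linfty (fam_bounded0 X).
Definition linfty_opp x : T := Linfty (fam_boundedN (linfty_bounded x)).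
Definition linfty_add x y : T :=
  Linfty (fam_boundedD (linfty_bounded x) (linfty_bounded y)).
Definition linfty_scale (a : R) x : T :=
  Linfty (fam_boundedZ a (linfty_bounded x)).

Fact linfty_addA : associative linfty_add.
Proof. by move=> x y z; apply: linfty_eq => i /=; rewrite addrA. Qed.
Fact linfty_addC : commutative linfty_add.
Proof. by move=> x y; apply: linfty_eq => i /=; rewrite addrC. Qed.
Fact linfty_add0 : left_id linfty_zero linfty_add.
Proof. by move=> x; apply: linfty_eq => i /=; rewrite add0r. Qed.
Fact linfty_addN : left_inverse linfty_zero linfty_opp linfty_add.
Proof. by move=> x; apply: linfty_eq => i /=; rewrite addNr. Qed.
HB.instance Definition _ :=
  GRing.isZmodule.Build T linfty_addA linfty_addC linfty_add0 linfty_addN.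

Fact linfty_scaleA a b x :
  linfty_scale a (linfty_scale b x) = linfty_scale (a * b) x.
Proof. by apply: linfty_eq => i /=; rewrite scalerA. Qed.
Fact linfty_scale1 : left_id 1 linfty_scale.
Proof. by move=> x; apply: linfty_eq => i /=; rewrite scale1r. Qed.
Fact linfty_scaleDr : right_distributive linfty_scale +%R.
Proof. by move=> a x y; apply: linfty_eq => i /=; rewrite scalerDr. Qed.
Fact linfty_scaleDl x : {morph linfty_scale^~ x : a b / a + b}.
Proof. by move=> a b; apply: linfty_eq => i /=; rewrite scalerDl. Qed.
HB.instance Definition _ := GRing.Zmodule_isLmodule.Build R T
  linfty_scaleA linfty_scale1 linfty_scaleDr linfty_scaleDl.

Fact linfty_normD x y :
  fam_norm (x + y : T) <= fam_norm x + fam_norm y.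
Proof. by apply: fam_normD; exact: linfty_bounded. Qed.
Fact linfty_normZ (a : R) x : fam_norm (a *: x : T) = `|a| * fam_norm x.
Proof. by apply: fam_normZ; exact: linfty_bounded. Qed.
Fact linfty_norm0_eq0 x : fam_norm x = 0 -> x = 0.
Proof.
move=> x0; apply: linfty_eq => i.
by apply: (fam_norm_eq0 _ x0); exact: linfty_bounded.
Qed.
HB.instance Definition _ := Lmodule_isNormed.Build R T
  linfty_normD linfty_normZ linfty_norm0_eq0.

End linfty_normed.

(* For the order x <= y :<-> K (y - x) induced by the cone K. *)
Definition MBI (R : realType) (V : normedModType R) (K : set V)
    (A : K -> K) : Prop :=
  exists2 xi : R -> R, class_Kinfty xi &
    forall v w : K, K (\val w - (\val v - \val (A v))) ->
      `|\val v| <= xi `|\val w|.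

Definition linfty_cone (R : realType) (I : Type) :
    set (linfty (fun _ : I => R^o)) :=
  [set s | forall i, 0 <= s i :> R].
Arguments linfty_cone : clear implicits.

Section Gamma_otimes.
Variables (R : realType) (I : Type) (gam : I -> I -> R -> R).
Hypothesis gamK0 : forall i j, class_K0 (gam i j).
Hypothesis gam_bounded :
  forall r : R, 0 < r -> has_ubound (range (fun ij : I * I => gam ij.1 ij.2 r)).

Definition Gamma_otimes_fun (s : linfty_cone R I) (i : I) : R :=
  sup (range (fun j => gam i j (\val s j))).

Fact cone_ge0 (s : linfty_cone R I) j : 0 <= \val s j :> R.
Proof. by have := set_mem (valP s); apply. Qed.

Fact Gamma_otimes_subproof (s : linfty_cone R I) :
  exists M : R, forall i j, gam i j (\val s j) <= M.
Proof.
have [M ubM] := gam_bounded (ltr_pwDr ltr01 (normr_ge0 (\val s))).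
exists M => i j; apply: (@le_trans _ _ (gam i j (`|\val s| + 1))).
  apply: class_K0_le (gamK0 i j) (cone_ge0 s j) _.
  rewrite (le_trans (ler_norm _))//.
  by rewrite (le_trans (fam_norm_ub j (linfty_bounded (\val s))))// lerDl.
by apply: ubM; exists (i, j).
Qed.

Fact Gamma_otimes_ge0 s i : 0 <= Gamma_otimes_fun s i.
Proof.
have [M hM] := Gamma_otimes_subproof s.
apply: (@le_trans _ _ (gam i i (\val s i))).
  exact: class_K0_ge0 (gamK0 i i) (cone_ge0 s i).
by apply: ub_le_sup; [exists M => _ [j _ <-]|exists i].
Qed.

Fact Gamma_otimes_bounded s :
  @fam_bounded R I (fun _ => R^o) (Gamma_otimes_fun s).
Proof.
have [M hM] := Gamma_otimes_subproof s; apply: (@fam_boundedP _ _ _ _ M) => i.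
rewrite ger0_norm ?Gamma_otimes_ge0//; apply: ge_sup.
  by exists (gam i i (\val s i)); exists i.
by move=> _ [j _ <-].
Qed.

Fact Gamma_otimes_cone s : linfty_cone R I (Linfty (Gamma_otimes_bounded s)).
Proof. exact: Gamma_otimes_ge0. Qed.

Definition Gamma_otimes (s : linfty_cone R I) : linfty_cone R I :=
  SigSub (mem_set (Gamma_otimes_cone s)).

End Gamma_otimes.

HB.instance Definition _ (R : realType) (i : interval int) :=
  PseudoMetric.copy {itv R & i}
    (initial_topology (fun t : {itv R & i} => t%:num)).

Section pcb.
Variable R : realType.
Local Notation Rp := {nonneg R}.

Definition addp (t s : Rp) : Rp := (t%:num + s%:num)%:nng.

Definition left_nbhs (t : Rp) : set_system Rp :=
  within [set s | s < t] (nbhs t).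
Definition right_nbhs (t : Rp) : set_system Rp :=
  within [set s | t < s] (nbhs t).

(* At t = 0 the left limit is vacuous, left_nbhs 0 being improper. *)
Definition piecewise_continuous (V : normedModType R) (w : Rp -> V) : Prop :=
  (forall T : Rp, finite_set [set t | t <= T /\ ~ continuous_at t w]) /\
  (forall t : Rp, cvg (w @ left_nbhs t) /\ cvg (w @ right_nbhs t)).

Record pcb (V : normedModType R) := Pcb {
  pcb_fun :> Rp -> V;
  pcb_bounded : @fam_bounded R Rp (fun _ => V) pcb_fun;
  pcb_pc : piecewise_continuous pcb_fun }.

Variable V : normedModType R.
Implicit Types (u v w : Rp -> V) (t s : Rp).

#[global] Instance left_nbhs_filter t : Filter (left_nbhs t) :=
  within_filter _ (nbhs_filter t).
#[global] Instance right_nbhs_filter t : Filter (right_nbhs t) :=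
  within_filter _ (nbhs_filter t).

Lemma pc0 : piecewise_continuous (fun _ => 0 : V).
Proof.
split=> [T|t]; last by split; exact: is_cvg_cst.
rewrite (_ : [set t | _] = set0); first exact: finite_set0.
rewrite -subset0 => t -[_ n]; case: n; exact: cst_continuous.
Qed.

Lemma pcN w : piecewise_continuous w -> piecewise_continuous (fun t => - w t).
Proof.
move=> [h1 h2]; split=> [T|t].
  apply: sub_finite_set (h1 T) => t [tT n]; split=> // c; apply: n.
  exact: (cvgN c).
have [hl hr] := h2 t; split.
  exact: (is_cvgN hl).
exact: (is_cvgN hr).
Qed.

Lemma pcD u v : piecewise_continuous u -> piecewise_continuous v ->
  piecewise_continuous (fun t => u t + v t).
Proof.
move=> [u1 u2] [v1 v2]; split=> [T|t].
  apply: (@sub_finite_set _ _ ([set t | t <= T /\ ~ continuous_at t u] `|`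
                               [set t | t <= T /\ ~ continuous_at t v])).
    move=> t [tT n].
    have [cu|] := pselect (continuous_at t u); last by left.
    have [cv|] := pselect (continuous_at t v); last by right.
    by exfalso; apply: n; exact: (cvgD cu cv).
  by rewrite finite_setU; split; [exact: u1|exact: v1].
have [ul ur] := u2 t; have [vl vr] := v2 t; split.
  exact: (is_cvgD ul vl).
exact: (is_cvgD ur vr).
Qed.

Lemma pcZ (a : R) w :
  piecewise_continuous w -> piecewise_continuous (fun t => a *: w t).
Proof.
move=> [h1 h2]; split=> [T|t].
  apply: sub_finite_set (h1 T) => t [tT n]; split=> // c; apply: n.
  exact: (cvgZ (cvg_cst a) c).
have [hl hr] := h2 t; split.
  exact: (is_cvgZ (is_cvg_cst a) hl).
exact: (is_cvgZ (is_cvg_cst a) hr).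
Qed.

Lemma ball_nngE t (e : R) s : ball t e s = (`|t%:num - s%:num| < e) :> Prop.
Proof. by []. Qed.

Definition subp (s t : Rp) : Rp := `|s%:num - t%:num|%:nng.

Lemma subpK s t : t <= s -> addp t (subp s t) = s.
Proof.
move=> ts; apply: val_inj => /=; rewrite ger0_norm ?subr_ge0//.
by rewrite addrC subrK.
Qed.

Lemma addpK s t : subp (addp t s) t = s.
Proof. by apply: val_inj => /=; rewrite addrAC subrr add0r ger0_norm. Qed.

Lemma addp_cvg t s : addp t x @[x --> s] --> addp t s.
Proof.
move=> A /nbhs_ballP[e /= e0 h]; apply/nbhs_ballP; exists e => //= x sx.
by apply: h; move: sx; rewrite !ball_nngE /= opprD addrACA subrr add0r.
Qed.

Lemma subp_cvg t s : subp x t @[x --> s] --> subp s t.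
Proof.
move=> A /nbhs_ballP[e /= e0 h]; apply/nbhs_ballP; exists e => //= x sx.
apply: h; move: sx; rewrite !ball_nngE /=; apply: le_lt_trans.
rewrite (le_trans (ler_dist_dist _ _))//.
by rewrite opprB addrA subrK.
Qed.

Lemma addp_cvgl t s : addp t x @[x --> left_nbhs s] --> left_nbhs (addp t s).
Proof.
move=> A; rewrite /left_nbhs /within => /addp_cvg h.
apply: (@filterS _ (nbhs s) (nbhs_filter s) _ _ _ h)
  => x /= hx xs; apply: hx; move: xs.
by rewrite -!num_lt /= ltrD2l.
Qed.

Lemma addp_cvgr t s : addp t x @[x --> right_nbhs s] --> right_nbhs (addp t s).
Proof.
move=> A; rewrite /right_nbhs /within => /addp_cvg h.
apply: (@filterS _ (nbhs s) (nbhs_filter s) _ _ _ h)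
  => x /= hx xs; apply: hx; move: xs.
by rewrite -!num_lt /= ltrD2l.
Qed.

Lemma nbhs_gt t s : t < s -> \forall x \near s, t < x.
Proof.
move=> ts; apply/nbhs_ballP; exists (s%:num - t%:num) => /=.
  by rewrite subr_gt0.
move=> x; rewrite ball_nngE => h; rewrite -num_lt.
by move: h; rewrite ltr_distlC => /andP[]; rewrite opprB addrC subrK.
Qed.

Lemma nbhs_lt t s : s < t -> \forall x \near s, x < t.
Proof.
move=> ts; apply/nbhs_ballP; exists (t%:num - s%:num) => /=.
  by rewrite subr_gt0.
move=> x; rewrite ball_nngE => h; rewrite -num_lt.
by move: h; rewrite ltr_distlC => /andP[_]; rewrite addrC subrK.
Qed.

Lemma subp_cvgl t s : t < s ->
  subp x t @[x --> left_nbhs s] --> left_nbhs (subp s t).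
Proof.
move=> ts A; rewrite /left_nbhs /within => /subp_cvg h.
apply: (@filterS2 _ (nbhs s) (nbhs_filter s) _ _ _ _ h (nbhs_gt ts))
  => x /= hx tx xs; apply: hx.
rewrite -num_lt /= !ger0_norm ?subr_ge0 ?num_le ?(ltW ts) ?(ltW tx)//.
by rewrite ltrD2r.
Qed.

Lemma subp_cvgr t s : t <= s ->
  subp x t @[x --> right_nbhs s] --> right_nbhs (subp s t).
Proof.
move=> ts A; rewrite /right_nbhs /within => /subp_cvg h.
apply: (@filterS _ (nbhs s) (nbhs_filter s) _ _ _ h) => x /= hx xs; apply: hx.
rewrite -num_lt /= !ger0_norm ?subr_ge0 ?num_le ?(ltW (le_lt_trans ts xs))//.
by rewrite ltrD2r.
Qed.

Lemma is_cvg_app (F G : set_system Rp) (m : Rp -> Rp) w :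
  m x @[x --> F] --> G -> cvg (w @ G) -> cvg ((w \o m) @ F).
Proof.
by move=> mFG /cvg_ex[l h]; apply/cvg_ex; exists l; apply: cvg_comp h.
Qed.

Lemma is_cvg_near (F : set_system Rp) (FF : Filter F) u w :
  (\forall x \near F, u x = w x) -> cvg (u @ F) -> cvg (w @ F).
Proof.
move=> uw /cvg_ex[l h]; apply/cvg_ex; exists l.
apply: cvg_trans h; apply: near_eq_cvg.
by apply: (@filterS _ F FF _ _ _ uw) => x ->.
Qed.

Lemma pc_shift w t :
  piecewise_continuous w -> piecewise_continuous (fun s => w (addp t s)).
Proof.
move=> [h1 h2]; split=> [T|s]; last first.
  have [hl hr] := h2 (addp t s); split.
    exact: (is_cvg_app (@addp_cvgl t s) hl).
  exact: (is_cvg_app (@addp_cvgr t s) hr).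
apply: sub_finite_set (finite_image (fun s => subp s t) (h1 (addp t T))).
move=> s [sT n]; exists (addp t s); last exact: addpK.
split; first by rewrite -num_le /= lerD2l.
by move=> c; apply: n; exact: (cvg_comp _ _ (@addp_cvg t s) c).
Qed.

Definition cat_fun t u v : Rp -> V :=
  fun s => if s <= t then u s else v (subp s t).

Lemma cat_fun_lt t u v s : s < t -> \forall x \near s, u x = cat_fun t u v x.
Proof.
move=> st; apply: (@filterS _ (nbhs s) (nbhs_filter s) _ _ _ (nbhs_lt st)).
by move=> x xt; rewrite /cat_fun (ltW xt).
Qed.

Lemma cat_fun_gt t u v s :
  t < s -> \forall x \near s, (v \o subp ^~ t) x = cat_fun t u v x.
Proof.
move=> st; apply: (@filterS _ (nbhs s) (nbhs_filter s) _ _ _ (nbhs_gt st)).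
by move=> x xt; rewrite /cat_fun leNgt xt.
Qed.

Lemma cvg_near_eq (F : set_system Rp) (FF : Filter F) u w (l : V) :
  (\forall x \near F, u x = w x) -> u @ F --> l -> w @ F --> l.
Proof.
move=> uw; apply: cvg_trans; apply: near_eq_cvg.
by apply: (@filterS _ F FF _ _ _ uw) => x ->.
Qed.

Lemma pc_cat t u v : piecewise_continuous u -> piecewise_continuous v ->
  piecewise_continuous (cat_fun t u v).
Proof.
move=> [u1 u2] [v1 v2]; split=> [T|s].
  apply: (@sub_finite_set _ _
    ([set s | s <= T /\ ~ continuous_at s u] `|` ([set t] `|`
     addp t @` [set s | s <= T /\ ~ continuous_at s v]))); last first.
    rewrite !finite_setU; split; first exact: u1.
    by split; [exact: finite_set1|apply: finite_image; exact: v1].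
  move=> s [sT n]; have [st|ts|->] := ltgtP s t; last by right; left.
    left; split=> // c; apply: n.
    have E : cat_fun t u v s = u s by rewrite /cat_fun (ltW st).
    rewrite /continuous_at E.
    exact: (cvg_near_eq (nbhs_filter s) (cat_fun_lt u v st) c).
  right; right; exists (subp s t); last by rewrite subpK// ltW.
  split.
    rewrite -num_le /= ger0_norm ?subr_ge0 ?num_le ?(ltW ts)//.
    by rewrite lerBlDr (@le_trans _ _ T%:num)// ?num_le// lerDl.
  move=> c; apply: n.
  have E : cat_fun t u v s = v (subp s t) by rewrite /cat_fun leNgt ts.
  rewrite /continuous_at E.
  exact: (cvg_near_eq (nbhs_filter s) (cat_fun_gt u v ts)
    (cvg_comp _ _ (@subp_cvg t s) c)).
have wl (P : Rp -> Prop) :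
    (\forall x \near s, P x) -> \forall x \near left_nbhs s, P x.
  by move=> h; apply: (@filterS _ (nbhs s) _ _ _ _ h) => x Px _.
have wr (P : Rp -> Prop) :
    (\forall x \near s, P x) -> \forall x \near right_nbhs s, P x.
  by move=> h; apply: (@filterS _ (nbhs s) _ _ _ _ h) => x Px _.
have lF := left_nbhs_filter s; have rF := right_nbhs_filter s.
have [ul ur] := u2 s; have [vl vr] := v2 (subp s t).
have [st|ts|E] := ltgtP s t.
- split.
    exact: (is_cvg_near lF (wl _ (cat_fun_lt u v st)) ul).
  exact: (is_cvg_near rF (wr _ (cat_fun_lt u v st)) ur).
- split.
    exact: (is_cvg_near lF (wl _ (cat_fun_gt u v ts))
      (is_cvg_app (subp_cvgl ts) vl)).
  exact: (is_cvg_near rF (wr _ (cat_fun_gt u v ts))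
    (is_cvg_app (subp_cvgr (ltW ts)) vr)).
- split.
    apply: (is_cvg_near lF _ ul).
    by apply: (@nearW _ (nbhs s) _ (nbhs_filter s)) => x /= xt;
      rewrite /cat_fun -E (ltW xt).
  have ts : t <= s by rewrite E.
  apply: (is_cvg_near rF _ (is_cvg_app (subp_cvgr ts) vr)).
  by apply: (@nearW _ (nbhs s) _ (nbhs_filter s)) => x /= xt;
      rewrite /cat_fun -E leNgt xt.
Qed.

End pcb.

Section pcb_normed.
Variables (R : realType) (V : normedModType R).
Local Notation T := (pcb V).
Local Notation Rp := {nonneg R}.
Implicit Types x y : T.

Lemma pcb_eq x y : (forall i, x i = y i) -> x = y.
Proof.
case: x y => [x bx cx] [y by_ cy] /= /funext E; subst y.
by congr Pcb; exact: Prop_irrelevance.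
Qed.

HB.instance Definition _ := gen_eqMixin T.
HB.instance Definition _ := gen_choiceMixin T.

Definition pcb_zero : T :=
  Pcb (fam_bounded0 (fun _ : Rp => V)) (pc0 V).
Definition pcb_opp x : T :=
  Pcb (fam_boundedN (pcb_bounded x)) (pcN (pcb_pc x)).
Definition pcb_add x y : T :=
  Pcb (fam_boundedD (pcb_bounded x) (pcb_bounded y))
      (pcD (pcb_pc x) (pcb_pc y)).
Definition pcb_scale (a : R) x : T :=
  Pcb (fam_boundedZ a (pcb_bounded x)) (pcZ a (pcb_pc x)).

Fact pcb_addA : associative pcb_add.
Proof. by move=> x y z; apply: pcb_eq => i /=; rewrite addrA. Qed.
Fact pcb_addC : commutative pcb_add.
Proof. by move=> x y; apply: pcb_eq => i /=; rewrite addrC. Qed.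
Fact pcb_add0 : left_id pcb_zero pcb_add.
Proof. by move=> x; apply: pcb_eq => i /=; rewrite add0r. Qed.
Fact pcb_addN : left_inverse pcb_zero pcb_opp pcb_add.
Proof. by move=> x; apply: pcb_eq => i /=; rewrite addNr. Qed.
HB.instance Definition _ :=
  GRing.isZmodule.Build T pcb_addA pcb_addC pcb_add0 pcb_addN.

Fact pcb_scaleA a b x : pcb_scale a (pcb_scale b x) = pcb_scale (a * b) x.
Proof. by apply: pcb_eq => i /=; rewrite scalerA. Qed.
Fact pcb_scale1 : left_id 1 pcb_scale.
Proof. by move=> x; apply: pcb_eq => i /=; rewrite scale1r. Qed.
Fact pcb_scaleDr : right_distributive pcb_scale +%R.
Proof. by move=> a x y; apply: pcb_eq => i /=; rewrite scalerDr. Qed.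
Fact pcb_scaleDl x : {morph pcb_scale^~ x : a b / a + b}.
Proof. by move=> a b; apply: pcb_eq => i /=; rewrite scalerDl. Qed.
HB.instance Definition _ := GRing.Zmodule_isLmodule.Build R T
  pcb_scaleA pcb_scale1 pcb_scaleDr pcb_scaleDl.

Definition pcb_norm x : R := @fam_norm R Rp (fun _ => V) x.

Fact pcb_normD x y : pcb_norm (x + y) <= pcb_norm x + pcb_norm y.
Proof. by apply: (@fam_normD R Rp (fun _ => V)); exact: pcb_bounded. Qed.
Fact pcb_normZ (a : R) x : pcb_norm (a *: x) = `|a| * pcb_norm x.
Proof. by apply: (@fam_normZ R Rp (fun _ => V)); exact: pcb_bounded. Qed.
Fact pcb_norm0_eq0 x : pcb_norm x = 0 -> x = 0.
Proof.
move=> x0; apply: pcb_eq => i.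
by apply: (@fam_norm_eq0 R Rp (fun _ => V) _ _ x0); exact: pcb_bounded.
Qed.
HB.instance Definition _ := Lmodule_isNormed.Build R T
  pcb_normD pcb_normZ pcb_norm0_eq0.

Fact pcb_shift_bounded (t : Rp) x :
  @fam_bounded R Rp (fun _ => V) (fun s => x (addp t s)).
Proof.
apply: (@fam_boundedP _ _ (fun _ => V) _ `|x|) => s.
by apply: (@fam_norm_ub R Rp (fun _ => V)); exact: pcb_bounded.
Qed.
Definition pcb_shift (t : Rp) x : T :=
  Pcb (pcb_shift_bounded t x) (pc_shift t (pcb_pc x)).

Fact pcb_cat_bounded (t : Rp) x y :
  @fam_bounded R Rp (fun _ => V) (cat_fun t x y).
Proof.
apply: (@fam_boundedP _ _ (fun _ => V) _ (Num.max `|x| `|y|)) => s.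
by rewrite /cat_fun le_max; case: ifP => _; apply/orP; [left|right];
  apply: (@fam_norm_ub R Rp (fun _ => V)); exact: pcb_bounded.
Qed.
Definition pcb_cat (t : Rp) x y : T :=
  Pcb (pcb_cat_bounded t x y) (pc_cat t (pcb_pc x) (pcb_pc y)).

End pcb_normed.

(* A linear subspace of U^{R_+}, carrying its own norm, is given as a normed
   module with an injective linear evaluation map into {nonneg R} -> U.
   input_shift and input_cat are determined by the conditions on them. *)
Record input_space (R : realType) := InputSpace {
  input_value : lmodType R;
  input_carrier :> normedModType R;
  input_eval : input_carrier -> {nonneg R} -> input_value;
  input_eval_linear : linear input_eval;
  input_eval_inj : injective input_eval;
  input_shift : {nonneg R} -> input_carrier -> input_carrier;
  input_shiftE : forall t u s,
    input_eval (input_shift t u) s = input_eval u (addp t s);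
  input_shift_norm : forall t u, `|input_shift t u| <= `|u|;
  input_cat : {nonneg R} -> input_carrier -> input_carrier -> input_carrier;
  input_cat_le : forall (t : {nonneg R}) u1 u2, 0 < t%:num ->
    forall s, s <= t -> input_eval (input_cat t u1 u2) s = input_eval u1 s;
  input_cat_gt : forall (t : {nonneg R}) u1 u2, 0 < t%:num ->
    forall s : {nonneg R}, 0 < s%:num ->
      input_eval (input_cat t u1 u2) (addp t s) = input_eval u2 s }.

Section pcb_inputs.
Variables (R : realType) (V : normedModType R).
Local Notation Rp := {nonneg R}.
Local Notation eval := (@pcb_fun R V).

Fact pcb_eval_linear : linear eval.
Proof. by move=> a u v; apply/funext. Qed.

Fact pcb_eval_inj : injective eval.
Proof. by move=> u v E; apply: pcb_eq => t; rewrite E. Qed.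

Fact pcb_shiftE t (u : pcb V) s : pcb_shift t u s = u (addp t s).
Proof. by []. Qed.

Fact pcb_shift_norm t (u : pcb V) : `|pcb_shift t u| <= `|u|.
Proof.
apply: (@fam_norm_le R _ (fun _ => V)) => [|s]; first exact: normr_ge0.
exact: (@fam_norm_ub R Rp (fun _ => V) u (addp t s) (pcb_bounded u)).
Qed.

Fact pcb_cat_le (t : Rp) (u v : pcb V) : 0 < t%:num ->
  forall s, s <= t -> pcb_cat t u v s = u s.
Proof. by move=> _ s h; rewrite /= /cat_fun h. Qed.

Fact pcb_cat_gt (t : Rp) (u v : pcb V) : 0 < t%:num ->
  forall s : Rp, 0 < s%:num -> pcb_cat t u v (addp t s) = v s.
Proof.
move=> _ s h; rewrite /= /cat_fun leNgt -num_lt /= ltrDl h /=.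
by rewrite addpK.
Qed.

Definition pcb_inputs : input_space R :=
  InputSpace pcb_eval_linear pcb_eval_inj
    pcb_shiftE pcb_shift_norm
    pcb_cat_le pcb_cat_gt.

End pcb_inputs.

(* The norm on a product of normed modules is the maximum of the norms. *)
Section prod_inputs.
Variables (R : realType) (U1 U2 : input_space R).
Local Notation Rp := {nonneg R}.
Local Notation T := (U1 * U2)%type.
Implicit Types u v : T.

Definition prod_eval u (t : Rp) : (input_value U1 * input_value U2)%type :=
  (input_eval u.1 t, input_eval u.2 t).
Definition prod_shift (t : Rp) u : T := (input_shift t u.1, input_shift t u.2).
Definition prod_cat (t : Rp) u v : T :=
  (input_cat t u.1 v.1, input_cat t u.2 v.2).

Fact prod_eval_linear : linear prod_eval.
Proof.
by move=> a u v; apply/funext => t; rewrite /prod_eval /= !input_eval_linear.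
Qed.

Fact prod_eval_inj : injective prod_eval.
Proof.
move=> [u1 u2] [v1 v2] E; congr (_, _); apply: input_eval_inj;
  by apply/funext => t; have [] := congr1 (fun f => f t) E.
Qed.

Fact prod_shiftE t u s : prod_eval (prod_shift t u) s = prod_eval u (addp t s).
Proof. by rewrite /prod_eval /= !input_shiftE. Qed.

Fact prod_shift_norm t u : `|prod_shift t u| <= `|u|.
Proof.
by rewrite !prod_normE /= ge_max !le_max !input_shift_norm orbT.
Qed.

Fact prod_cat_le (t : Rp) u v : 0 < t%:num ->
  forall s, s <= t -> prod_eval (prod_cat t u v) s = prod_eval u s.
Proof. by move=> t0 s st; rewrite /prod_eval /= !input_cat_le. Qed.

Fact prod_cat_gt (t : Rp) u v : 0 < t%:num -> forall s : Rp, 0 < s%:num ->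
  prod_eval (prod_cat t u v) (addp t s) = prod_eval v s.
Proof. by move=> t0 s s0; rewrite /prod_eval /= !input_cat_gt. Qed.

Definition prod_inputs : input_space R :=
  InputSpace prod_eval_linear prod_eval_inj prod_shiftE prod_shift_norm
    prod_cat_le prod_cat_gt.

End prod_inputs.

Section control_systems.
Variable R : realType.
Local Notation Rp := {nonneg R}.

(* A map defined on a subset of R_+ * X * U; its values off flow_dom are
   irrelevant. *)
Record flow (X : normedModType R) (U : input_space R) := Flow {
  flow_dom : Rp -> X -> U -> Prop;
  flow_map :> Rp -> X -> U -> X }.

Section flow.
Variables (X : normedModType R) (U : input_space R).
Implicit Types phi psi : flow X U.

Definition max_time phi (x : X) (u : U) (tm : \bar R) : Prop :=
  (0 < tm)%E /\ forall t : Rp, flow_dom phi t x u <-> (t%:num%:E < tm)%E.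

Record control_system phi : Prop := ControlSystem {
  cs_max_time : forall x u, exists tm, max_time phi x u tm;
  cs_identity : forall x u, phi 0%:nng x u = x;
  cs_causality : forall t x u v, flow_dom phi t x u ->
    (forall s : Rp, s <= t -> input_eval v s = input_eval u s) ->
    (forall s : Rp, s <= t -> flow_dom phi s x v) /\ phi t x u = phi t x v;
  cs_continuity : forall x u,
    {within [set t : Rp | flow_dom phi t x u], continuous (fun t => phi t x u)};
  cs_cocycle : forall t h x u,
    (forall s : Rp, s <= addp t h -> flow_dom phi s x u) ->
    flow_dom phi h (phi t x u) (input_shift t u) /\
    phi h (phi t x u) (input_shift t u) = phi (addp t h) x u }.

Definition forward_complete phi : Prop := forall t x u, flow_dom phi t x u.

Definition BIC phi : Prop :=
  forall x u tm (M : R), max_time phi x u tm -> (tm < +oo)%E -> 0 < M ->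
    exists2 t : Rp, (t%:num%:E < tm)%E & M < `|phi t x u|.

Definition UGS phi : Prop :=
  exists sigma gamma : R -> R,
    [/\ class_Kinfty sigma, class_K0 gamma &
        forall t x u, flow_dom phi t x u ->
          `|phi t x u| <= sigma `|x| + gamma `|u|].

Definition flow_ext phi psi : Prop :=
  forall t x u, flow_dom phi t x u ->
    flow_dom psi t x u /\ psi t x u = phi t x u.

End flow.

Section interconnection.
Variables (I : Type) (X : I -> normedModType R) (U : input_space R).

Definition except (i : I) : normedModType R :=
  linfty (fun j : {j : I | j <> i} => X (sval j)).

Fact restrict_subproof (i : I) (x : linfty X) :
  @fam_bounded R _ (fun j : {j : I | j <> i} => X (sval j))
    (fun j => x (sval j)).
Proof.
apply: (@fam_boundedP _ _ (fun j : {j : I | j <> i} => X (sval j)) _ `|x|).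
by move=> j; apply: fam_norm_ub; exact: linfty_bounded.
Qed.
Definition restrict (i : I) (x : linfty X) : except i :=
  Linfty (restrict_subproof i x).

Definition sub_inputs (i : I) : input_space R :=
  prod_inputs (pcb_inputs (except i)) U.

Variable phib : forall i, flow (X i) (sub_inputs i).
Implicit Types phi psi : flow (linfty X) U.

(* phi_{<>i} enters phib i through any w in PC_b agreeing with it on [0, t];
   by causality of phib i the choice of w is immaterial. *)
Definition solution_map phi : Prop :=
  (forall x u, exists2 e : Rp, 0 < e%:num &
     forall t : Rp, t <= e -> flow_dom phi t x u) /\
  (forall t x u i, flow_dom phi t x u ->
     exists w : pcb (except i),
       [/\ forall s : Rp, s <= t ->
             flow_dom phi s x u /\ w s = restrict i (phi s x u),
           flow_dom (phib i) t (x i) (w, u) &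
           phi t x u i = phib i t (x i) (w, u)]).

Definition maximal_solution_map phi : Prop :=
  solution_map phi /\
  forall psi, solution_map psi -> flow_ext phi psi -> flow_ext psi phi.

Definition well_defined_interconnection phi : Prop :=
  [/\ maximal_solution_map phi,
      forall psi, maximal_solution_map psi ->
        flow_ext phi psi /\ flow_ext psi phi,
      control_system phi &
      BIC phi].

Definition norm_on (V : normedModType R) (J : set Rp) (w : Rp -> V) : R :=
  sup [set `|w s| | s in J].

(* The element 0 of the set whose supremum is taken is the term j = i. *)
Definition UGS_semimax (i : I) (sigma : R -> R) (gam : I -> R -> R)
    (gamu : R -> R) : Prop :=
  [/\ forward_complete (phib i),
      forall r : R, 0 <= r -> has_ubound (range (fun j => gam j r)),
      forall r : R, 0 <= r -> gam i r = 0 &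
      forall (t : Rp) (xi : X i) (w : pcb (except i)) (u : U),
        `|phib i t xi (w, u)| <=
          sigma `|xi|
          + sup ([set 0] `|`
                 range (fun j : {j : I | j <> i} =>
                   gam (sval j) (norm_on [set s | s <= t] (fun s => w s j))))
          + gamu `|u|].

End interconnection.
End control_systems.

(* Main.v *)
(* Along a trajectory, let v_i be the supremum over [0, t] of the norm of the
   i-th component. The UGS estimates of the subsystems say exactly that
   (id - Gamma_otimes) v is bounded by the constant family
   sigma_max |x| + gamma_max |u|, so the MBI property bounds |v|, hence the
   trajectory, uniformly in t; the BIC property then excludes finite escape. *)

Require Import Defs.
From mathcomp Require Import all_boot all_order all_algebra.
From mathcomp Require Import interval_inference.
From mathcomp Require Import all_classical all_reals topology normedtype.

Import Order.TTheory GRing.Theory Num.Theory.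
Import numFieldNormedType.Exports.
Local Open Scope classical_set_scope.
Local Open Scope ring_scope.

Set Implicit Arguments.
Unset Strict Implicit.

Lemma class_Kinfty_K0 (R : realType) (g : R -> R) :
  class_Kinfty g -> class_K0 g.
Proof. by case; left. Qed.

Lemma class_Kinfty_scale (R : realType) (c : R) :
  0 < c -> class_Kinfty ( *%R c).
Proof.
move=> c0; split; first split.
- exact: mulr0.
- by apply: continuous_subspaceT => r; exact: mulrl_continuous.
- by move=> r s _; rewrite ltr_pM2l.
move=> M; exists ((`|M| + 1) / c).
  by rewrite divr_ge0 ?addr_ge0// ltW.
by rewrite mulrC divfK ?gt_eqF// ltr_pwDr// ler_norm.
Qed.

Lemma class_Kinfty_comp (R : realType) (f g : R -> R) :
  class_Kinfty f -> class_Kinfty g -> class_Kinfty (fun r => f (g r)).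
Proof.
move=> fKoo gKoo.
have g_ge0 r : 0 <= r -> 0 <= g r.
  exact/class_K0_ge0/class_Kinfty_K0.
case: fKoo gKoo => -[f0 fc fi] fu [[g0 gc gi] gu].
split; first split.
- by rewrite g0.
- apply/subspace_continuousP => r /= r0.
  have := (subspace_continuousP _ _).1 fc (g r) (g_ge0 r r0).
  have := (subspace_continuousP _ _).1 gc r r0.
  (* [g] maps the half-line into itself, so continuity of [f] relative to the half-line can be
     pulled back along [g]. *)
  move=> gr fgr; apply: cvg_trans fgr => A.
  move=> /gr; rewrite /nbhs /= /within /= => h.
  by apply: filterS h => s h s0; exact: h (g_ge0 s s0).
- by move=> r s r0 rs; apply: fi (g_ge0 r r0) (gi r s r0 rs).
move=> M; have [r r0 Mr] := fu M; have [s s0 rs] := gu r.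
by exists s => //; exact: lt_trans Mr (fi r (g s) r0 rs).
Qed.

(** As [a + b] is at most twice the larger summand, monotonicity bounds the left side by one term on
    the right, and the other is nonnegative. This later separates the state from the input
    contribution inside [xi]. *)
Lemma class_K0_weak_triangle (R : realType) (f : R -> R) (a b : R) :
  class_K0 f -> 0 <= a -> 0 <= b -> f (a + b) <= f (2 * a) + f (2 * b).
Proof.
move=> fK0 a0 b0; have ab0 := addr_ge0 a0 b0.
have [ab|/ltW ba] := leP a b.
  rewrite (@le_trans _ _ (f (2 * b)))//.
    by apply: class_K0_le => //; rewrite mulr2n mulrDl !mul1r lerD2r.
  by rewrite lerDr class_K0_ge0// mulr_ge0.
rewrite (@le_trans _ _ (f (2 * a)))//.
  by apply: class_K0_le => //; rewrite mulr2n mulrDl !mul1r lerD2l.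
by rewrite lerDl class_K0_ge0// mulr_ge0.
Qed.

(** A finite [tm] would let BIC produce a value above any threshold, against the bound [M]. *)
Lemma BIC_forward_complete (R : realType) (X : normedModType R)
    (U : input_space R) (phi : flow X U) :
  control_system phi -> BIC phi ->
  (forall x u, exists M : R, forall t, flow_dom phi t x u -> `|phi t x u| <= M) ->
  forward_complete phi.
Proof.
move=> cs bic bnd t x u; have [tm htm] := cs_max_time cs x u.
apply/(htm.2 t); have [M hM] := bnd x u.
case: (ltP tm +oo%E) => [tmoo|]; last first.
  by rewrite leye_eq => /eqP ->; exact: ltry.
have M1 : 0 < `|M| + 1 by rewrite ltr_pwDr.
have [s stm] := bic x u tm _ htm tmoo M1.
rewrite ltNge (le_trans (hM s _))//; first exact/(htm.2 s).
by rewrite (le_trans (ler_norm M))// lerDl.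
Qed.

Section trajectory_bound.
Context (R : realType) (I : Type) (X : I -> normedModType R)
  (U : input_space R) (phib : forall i, flow (X i) (sub_inputs X U i))
  (phi : flow (linfty X) U).
Hypothesis phi_sol : solution_map phib phi.
Context (sigma : I -> R -> R) (gam : I -> I -> R -> R) (gamu : I -> R -> R).
Hypothesis gam_K0 : forall i j, class_K0 (gam i j).
Hypothesis phib_UGS :
  forall i, UGS_semimax phib i (sigma i) (gam i) (gamu i).
Hypothesis gam_sup : forall r : R, 0 < r ->
  has_ubound (range (fun ij : I * I => gam ij.1 ij.2 r)).
Local Notation Rp := {nonneg R}.

(** The internal input of any one subsystem comes with the trajectory on all of [0, t]; an element
    of [I] supplies that subsystem. *)
Lemma solution_dom_le t s x u : inhabited I ->
  flow_dom phi t x u -> s <= t -> flow_dom phi s x u.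
Proof.
move=> [i] td st; have [w [h _ _]] := phi_sol.2 t x u i td.
by have [] := h s st.
Qed.

(** [v] and [S] are arbitrary majorants so that the estimate serves twice: with a crude constant to
    get boundedness, then with suprema over [0, t] and [Gamma_otimes]. Excluding [j = i] lets it
    apply before component [i] is known to be bounded. *)
Lemma solution_component_bound t x u i (v : I -> R) :
  flow_dom phi t x u -> (forall j, j <> i -> 0 <= v j) ->
  (forall j (s : Rp), j <> i -> s <= t -> `|phi s x u j| <= v j) ->
  forall S, 0 <= S -> (forall j, j <> i -> gam i j (v j) <= S) ->
  `|phi t x u i| <= sigma i `|x i| + S + gamu i `|u|.
Proof.
move=> td v0 hv S S0 hS; have [w [hw _ ->]] := phi_sol.2 t x u i td.
have [_ _ _ ugs] := phib_UGS i.
rewrite (le_trans (ugs t (x i) w u))// lerD2r lerD2l.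
apply: ge_sup; first by exists 0; left.
move=> _ [->//|[[j ji] _ <-]] /=; rewrite (le_trans _ (hS j ji))//.
have ne : [set `|w s (exist _ j ji)| | s in [set s : Rp | s <= t]] !=set0.
  by exists `|w 0%:nng (exist _ j ji)|; exists 0%:nng => //=; rewrite -num_le /=.
have ub : ubound [set `|w s (exist _ j ji)| | s in [set s : Rp | s <= t]] (v j).
  by move=> _ [s /= st <-]; have [_ ->] := hw s st; exact: hv.
(* Gains are monotone on nonnegative arguments, so [norm_on] must be shown nonnegative: it dominates
   the norm at some time in [0, t]. *)
apply: class_K0_le => //; last exact: ge_sup.
have [_ [s /= st _]] := ne.
apply: le_trans (normr_ge0 (w s (exist _ j ji))) _.
by apply: ub_le_sup; [exists (v j)|exists s].
Qed.

(* A global bound on a trajectory piece comes for free: all components but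
   the [i0]-th are bounded by the norm of the internal input of the [i0]-th
   subsystem, and the remaining one by the gain estimate. *)
Lemma solution_bounded t x u : inhabited I -> flow_dom phi t x u ->
  exists M, forall i (s : Rp), s <= t -> `|phi s x u i| <= M.
Proof.
move=> [i0] td; have [w [hw _ _]] := phi_sol.2 t x u i0 td.
have wb j (s : Rp) : j <> i0 -> s <= t -> `|phi s x u j| <= `|w|.
  move=> ji st; have [_ E] := hw s st.
  have -> : phi s x u j = w s (exist _ j ji) by rewrite E.
  apply: le_trans (fam_norm_ub (exist _ j ji) (linfty_bounded (w s))) _.
  exact: (@fam_norm_ub R Rp (fun _ => except X i0) w s (pcb_bounded w)).
(* The uniform gain bound is given at positive radii, hence the shift by 1. *)
have [S hS] := gam_sup (ltr_pwDr ltr01 (normr_ge0 w)).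
have {}hS j : gam i0 j `|w| <= S.
  apply: (@le_trans _ _ (gam i0 j (`|w| + 1))); last by apply: hS; exists (i0, j).
  by apply: class_K0_le => //; rewrite lerDl.
have S0 : 0 <= S by apply: le_trans (hS i0); exact: class_K0_ge0.
exists (Num.max `|w| (sigma i0 `|x i0| + S + gamu i0 `|u|)) => i s st.
rewrite le_max; have [->|ii0] := pselect (i = i0); last by rewrite wb.
apply/orP; right.
apply: (@solution_component_bound s x u i0 (fun=> `|w|)) => //.
- exact: solution_dom_le td st.
- by move=> j r ji rs; apply: wb => //; exact: le_trans rs st.
Qed.

Lemma solution_MBI_bound (xi : R -> R) (c : R) t (x : linfty X) (u : U) :
  inhabited I ->
  (forall v w : linfty_cone R I,
    linfty_cone R I (\val w - (\val v - \val (Gamma_otimes gam_K0 gam_sup v))) ->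
    `|\val v| <= xi `|\val w|) ->
  (forall i, sigma i `|x i| + gamu i `|u| <= c) -> 0 <= c ->
  flow_dom phi t x u -> `|phi t x u| <= xi c.
Proof.
move=> I0 mbi hc c0 td; have [M hM] := solution_bounded I0 td.
pose A i := [set `|phi s x u i| | s in [set s : Rp | s <= t]].
have A0 i : A i !=set0.
  by exists `|phi t x u i|; exists t => /=.
have Aub i (s : Rp) : s <= t -> `|phi s x u i| <= sup (A i).
  by move=> st; apply: ub_le_sup; [exists M => _ [r /= rt <-]; exact: hM|exists s].
have v0 i : 0 <= sup (A i) by exact: le_trans (normr_ge0 _) (Aub i t (lexx t)).
have vM i : sup (A i) <= M by apply: ge_sup => // _ [r /= rt <-]; exact: hM.
have vb : @fam_bounded R I (fun=> R^o) (fun i => sup (A i)).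
  by apply: (@fam_boundedP _ _ (fun=> R^o) _ M) => i; rewrite ger0_norm.
have wb : @fam_bounded R I (fun=> R^o) (fun=> c).
  by apply: (@fam_boundedP _ _ (fun=> R^o) _ c) => i; rewrite ger0_norm.
have vK : linfty_cone R I (Linfty vb) by [].
have wK : linfty_cone R I (Linfty wb) by [].
pose v : linfty_cone R I := SigSub (mem_set vK).
pose w : linfty_cone R I := SigSub (mem_set wK).
(* Equality is needed because [xi] is not assumed monotone here; the lower bound uses an element of
   [I]. *)
have nw : `|\val w| = c.
  have [i] := I0; apply/le_anti/andP; split.
    by apply: (@fam_norm_le _ _ (fun=> R^o)) => // j; rewrite /= ger0_norm.
  have := @fam_norm_ub _ _ (fun=> R^o) (Linfty wb) i wb.
  by rewrite /= ger0_norm.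
rewrite -nw; apply: (@le_trans _ _ `|\val v|).
  apply: fam_norm_le => // i; rewrite (le_trans (Aub i t (lexx t)))//.
  have := @fam_norm_ub _ _ (fun=> R^o) (Linfty vb) i vb.
  by rewrite /= ger0_norm.
apply: mbi => i.
(* In coordinate [i] the MBI premise says [sup (A i) <= c + Gamma_otimes_fun gam v i]. It is checked
   at each time [s <= t], with [v] taken over all of [0, t], so the right side does not depend on
   [s]. *)
change (0 <= c - (sup (A i) - Gamma_otimes_fun gam v i)).
rewrite subr_ge0 lerBlDr; apply: ge_sup => // _ [s /= st <-].
have [G hG] := Gamma_otimes_subproof gam_K0 gam_sup v.
apply: (@le_trans _ _
  (sigma i `|x i| + Gamma_otimes_fun gam v i + gamu i `|u|)); last first.
  by rewrite addrAC lerD2r.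
apply: (@solution_component_bound s x u i (fun j => sup (A j))) => //.
- exact: solution_dom_le td st.
- by move=> j r _ rs; apply: Aub; exact: le_trans rs st.
- exact: Gamma_otimes_ge0.
- by move=> j _; apply: ub_le_sup; [exists G => _ [k _ <-]|exists j].
Qed.

End trajectory_bound.

Unset Implicit Arguments.
Set Strict Implicit.

Theorem theorem6p1 (R : realType) (I : Type) (I_nonempty : inhabited I)
  (X : I -> normedModType R) (U : input_space R)
  (phib : forall i, flow (X i) (sub_inputs X U i))
  (phib_cs : forall i, control_system (phib i))
  (phib_fc : forall i, forward_complete (phib i))
  (phi : flow (linfty X) U)
  (phi_wd : well_defined_interconnection phib phi)
  (sigma : I -> R -> R) (gam : I -> I -> R -> R) (gamu : I -> R -> R)
  (sigma_K : forall i, class_K (sigma i))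
  (gam_K0 : forall i j, class_K0 (gam i j))
  (gamu_K0 : forall i, class_K0 (gamu i))
  (phib_UGS : forall i, UGS_semimax phib i (sigma i) (gam i) (gamu i))
  (bounds : exists sigma_max gamma_max : R -> R,
     [/\ class_Kinfty sigma_max, class_Kinfty gamma_max,
         forall i (r : R), 0 <= r -> sigma i r <= sigma_max r &
         forall i (r : R), 0 <= r -> gamu i r <= gamma_max r])
  (gam_sup : forall r : R, 0 < r ->
     has_ubound (range (fun ij : I * I => gam ij.1 ij.2 r)))
  (gam_MBI : MBI (Gamma_otimes gam_K0 gam_sup)) :
  forward_complete phi /\ UGS phi.
Proof.
case: phi_wd => -[sol _] _ cs bic; case: bounds => smax [gmax [sK gK hs hg]].
case: gam_MBI => xi xiK mbi.
have K2 := @class_Kinfty_scale R 2 (ltr0Sn _ 1).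
have s0 r : 0 <= r -> 0 <= smax r by exact/class_K0_ge0/class_Kinfty_K0.
have g0 r : 0 <= r -> 0 <= gmax r by exact/class_K0_ge0/class_Kinfty_K0.
(* The right side is free of [t]: it rules out finite escape and also supplies the two UGS
   functions. The factors 2 come from the weak triangle inequality for [xi]. *)
have bnd t x u : flow_dom phi t x u ->
    `|phi t x u| <= xi (2 * smax `|x|) + xi (2 * gmax `|u|).
  move=> td; apply: (@le_trans _ _ (xi (smax `|x| + gmax `|u|))); last first.
    by apply: class_K0_weak_triangle; rewrite ?s0 ?g0//; exact: class_Kinfty_K0.
  apply: (solution_MBI_bound sol phib_UGS I_nonempty mbi) td.
    move=> i; rewrite lerD ?hg// (le_trans (hs i _ _))//.
    apply: class_K0_le => //; first exact: class_Kinfty_K0.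
    exact: fam_norm_ub (linfty_bounded x).
  by rewrite addr_ge0 ?s0 ?g0.
split.
  apply: BIC_forward_complete => // x u.
  by exists (xi (2 * smax `|x|) + xi (2 * gmax `|u|)) => t; exact: bnd.
exists (fun r => xi (2 * smax r)), (fun r => xi (2 * gmax r)); split => //.
  exact: class_Kinfty_comp xiK (class_Kinfty_comp K2 sK).
exact/class_Kinfty_K0/(class_Kinfty_comp xiK (class_Kinfty_comp K2 gK)).
Qed.
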